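(* In the following setting, suppose it is known that $T$ is convex. Then the perimeter length $L(T)$ and the area $|T|$ are observable, and no other parameter of $T$ (i.e., no quantity not determined by $L(T)$ and $|T|$) is observable. Setting: $\Omega\subset\mathbb{R}^2$ has finite area $|\Omega|$, $T\subset\Omega$ is a polygon, $r_{max}>0$, and every point within distance $r_{max}$ of $T$ lies in $\Omega$; a sensor at a location uniform in $\Omega$ with independent direction $\theta$ uniform in $[0,2\pi)$ reports $s=\min\{t\in[0,r_{max}]:(x+t\cos\theta,y+t\sin\theta)\in T\}$, or no detection if this set is empty.
   Context: Observability: write $\Pr(s\le r\mid\rho,\rho')$ for the distribution function of the measured distance when the target's parameter vectors are $\rho$ and $\rho'$. The parameter vector $\rho$ is observable if and only if there exists a finite set of values $\{\Pr(s\le s_i\mid\rho,\rho')\}_i$ that uniquely determines $\rho$. *)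

(* Defs.v *)
From HB Require Import structures.
From mathcomp Require Import all_boot all_order all_algebra.
From mathcomp Require Import all_classical all_reals all_analysis.
Set Implicit Arguments. Unset Strict Implicit. Unset Printing Implicit Defensive.
Import Order.TTheory GRing.Theory Num.Theory.
Import numFieldNormedType.Exports.
Local Open Scope classical_set_scope.
Local Open Scope ring_scope.

Section Sensor.
Variable R : realType.

Notation pt := (R * R)%type.

Definition leb2 := ((@lebesgue_measure R) \x (@lebesgue_measure R))%E.
Definition leb3 := (leb2 \x (@lebesgue_measure R))%E.

Definition area (A : set pt) : R := fine (leb2 A).

Definition dist (p q : pt) : R :=
  Num.sqrt ((p.1 - q.1) ^+ 2 + (p.2 - q.2) ^+ 2).

(* event {s <= r}: the ray from z.1 in direction z.2 meets T at some distance
   t in [0, r] with t <= r_max (T is closed, so the minimum is attained). *)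
Definition hit (T : set pt) (rmax r : R) : set (pt * R) :=
  [set z | exists t : R, [/\ 0 <= t, t <= r, t <= rmax &
        T (z.1.1 + t * cos z.2, z.1.2 + t * sin z.2)]].

(* Pr(s <= r): (x,y) uniform on Omega, theta uniform on [0, 2 pi), independent *)
Definition prob_s_le (Omega T : set pt) (rmax r : R) : R :=
  fine (leb3 ((Omega `*` [set th | 0 <= th < 2 * pi]) `&` hit T rmax r))
  / (2 * pi * area Omega).

Definition cross (u w : pt) : R := u.1 * w.2 - u.2 * w.1.
Definition vsub (p q : pt) : pt := (p.1 - q.1, p.2 - q.2).

(* v_0, ..., v_{n-1} are the vertices, in counterclockwise order, of a
   (non-degenerate) convex polygon: n >= 3 and every other vertex lies strictly
   to the left of each edge line. *)
Definition convex_polygon_vertices (n : nat) (v : 'I_n -> pt) : Prop :=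
  (3 <= n)%N /\
  forall i j : 'I_n, j != i -> j != ordS i ->
    0 < cross (vsub (v (ordS i)) (v i)) (vsub (v j) (v i)).

Definition polygon (n : nat) (v : 'I_n -> pt) : set pt :=
  [set p | exists w : 'I_n -> R, [/\ forall i, 0 <= w i,
      \sum_(i < n) w i = 1 &
      p = (\sum_(i < n) w i * (v i).1, \sum_(i < n) w i * (v i).2)]].

Definition perimeter (n : nat) (v : 'I_n -> pt) : R :=
  \sum_(i < n) dist (v (ordS i)) (v i).

Definition admissible (Omega T : set pt) (rmax : R) : Prop :=
  T `<=` Omega /\ forall p, (exists2 q, T q & dist p q <= rmax) -> Omega p.

Definition adm_target (Omega : set pt) (rmax : R) (n : nat) (v : 'I_n -> pt)
  : Prop := convex_polygon_vertices v /\ admissible Omega (polygon v) rmax.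

Definition observable (Omega : set pt) (rmax : R) (X : Type)
  (rho : forall n : nat, ('I_n -> pt) -> X) : Prop :=
  exists (k : nat) (s : 'I_k -> R),
    forall (n1 : nat) (v1 : 'I_n1 -> pt) (n2 : nat) (v2 : 'I_n2 -> pt),
      adm_target Omega rmax v1 -> adm_target Omega rmax v2 ->
      (forall i, prob_s_le Omega (polygon v1) rmax (s i)
               = prob_s_le Omega (polygon v2) rmax (s i)) ->
      rho n1 v1 = rho n2 v2.

End Sensor.

(* Main.v *)
Require Import Defs.
From HB Require Import structures.
From mathcomp Require Import all_boot all_order all_algebra.
From mathcomp Require Import all_classical all_reals all_analysis.
From mathcomp Require Import measurable_realfun ring lra.
Set Implicit Arguments. Unset Strict Implicit. Unset Printing Implicit Defensive.
Import Order.TTheory GRing.Theory Num.Theory.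
Import numFieldNormedType.Exports.
Local Open Scope classical_set_scope.
Local Open Scope ring_scope.

(** For a fixed direction u, the sensor positions that detect T within range r
    form the sweep T - [0, r] u. Slicing along u shows that its area is
    |T| + r w(u), where w(u) is the width of T orthogonal to u: every nonempty
    slice of T is a segment that gets longer by r. For a convex polygon, the
    function cross(u, .) goes once up and once down along the boundary, hence
    2 w(u) is the sum of |cross(u, e)| over the edges e. Integrating over the
    direction, each edge contributes 4 |e|, and the detection event has measure
    2 pi |T| + 2 r L(T) for 0 <= r <= rmax (Cauchy's formula). This depends on T
    only through L(T) and |T|, and its values at r = 0 and r = rmax determine
    both. *)

(** * Countable bases, and measurability of open and compact sets in products *)

Section CountableBase.

(** The members of [B] need not be open; for measurability it suffices that every open set is a
    countable union of them. *)
Definition nat_base (T : topologicalType) (B : nat -> set T) :=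
  forall x U, nbhs x U -> exists2 n, B n x & B n `<=` U.

Lemma open_bigcup_base (T : topologicalType) (B : nat -> set T) (U : set T) :
  nat_base B -> open U -> U = \bigcup_(n in [set n | B n `<=` U]) B n.
Proof.
move=> bB oU; apply/seteqP; split=> [x Ux|x [n nU]]; last exact: nU.
by have [n Bnx nU] := bB x U (open_nbhs_nbhs (conj oU Ux)); exists n.
Qed.

(** Pairs of indices are coded by one natural number. A number that codes no pair gives the empty
    set, which is measurable and does no harm. *)
Definition prod_base (T1 T2 : topologicalType) (B1 : nat -> set T1)
    (B2 : nat -> set T2) (n : nat) : set (T1 * T2) :=
  if unpickle n is Some ij then B1 ij.1 `*` B2 ij.2 else set0.

Lemma prod_nat_base (T1 T2 : topologicalType) (B1 : nat -> set T1)
    (B2 : nat -> set T2) :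
  nat_base B1 -> nat_base B2 -> nat_base (prod_base B1 B2).
Proof.
move=> b1 b2 [x y] U [[U1 U2] [/= /b1[i ix iU] /b2[j jy jU]] sU].
exists (pickle (i, j)); rewrite /prod_base pickleK //= => -[a b] [/= ia jb].
by apply: sU; split; [exact: iU|exact: jU].
Qed.

Variable R : realType.

(** The base consists of the balls with rational centre and radius. *)
Lemma real_nat_base : exists2 B : nat -> set R,
  nat_base B & forall n, measurable (B n).
Proof.
pose B n : set R :=
  if @unpickle (rat * rat)%type n is Some q
  then ball (ratr q.1 : R) (ratr q.2) else set0.
exists B => [x U|n]; last first.
  rewrite /B; case: unpickle => [q|//].
  by rewrite ball_itv; exact: measurable_itv.
rewrite nbhsE => -[V [oV Vx] VU].
have [c [r [/set_mem cx crV]]] := open_subball_rat oV (mem_set Vx).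
exists (pickle (c, r)); rewrite /B pickleK //=.
exact: subset_trans VU.
Qed.

(** The product sigma-algebra is generated by rectangles, so the open set is first written as a
    countable union of rectangles. *)
Lemma open_measurable2 (U : set (R * R)) : open U -> measurable U.
Proof.
move=> oU; have [B bB mB] := real_nat_base.
rewrite (open_bigcup_base (prod_nat_base bB bB) oU).
apply: bigcup_measurable => n _; rewrite /prod_base.
by case: unpickle => [[i j]|//]; exact: measurableX.
Qed.

Lemma open_measurable3 (U : set (R * R * R)) : open U -> measurable U.
Proof.
move=> oU; have [B bB mB] := real_nat_base.
rewrite (open_bigcup_base (prod_nat_base (prod_nat_base bB bB) bB) oU).
apply: bigcup_measurable => n _; rewrite /prod_base.
case: unpickle => [[i j]|//]; apply: measurableX => //=.
by case: unpickle => [[k l]|//]; exact: measurableX.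
Qed.

Lemma compact_measurable2 (K : set (R * R)) : compact K -> measurable K.
Proof.
move=> /compact_closed -/(_ (@norm_hausdorff _ _)) cK.
rewrite -(setCK K); apply: measurableC.
by apply: open_measurable2; exact: closed_openC.
Qed.

Lemma compact_measurable3 (K : set (R * R * R)) : compact K -> measurable K.
Proof.
move=> /compact_closed -/(_ (@norm_hausdorff _ _)) cK.
rewrite -(setCK K); apply: measurableC.
by apply: open_measurable3; exact: closed_openC.
Qed.

End CountableBase.

(** * Compactness and convexity of the convex hull of the vertices *)

Section Polygon.
Variables (R : realType) (n : nat) (v : 'I_n -> R * R).

Let comb (c : 'I_n -> R) (w : 'rV[R]_n) : R := \sum_(i < n) w ord0 i * c i.

Let comb_continuous c : continuous (comb c).
Proof.
rewrite /comb; apply: continuous_big => [|i _]; first exact: add_continuous.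
have h : continuous (fun w : 'rV[R]_n => w ord0 i).
  by move=> w; exact: coord_continuous.
by move=> w; apply: (@cvgM _ _ (nbhs w)); [exact: h|exact: cvg_cst].
Qed.

(** The polygon is the continuous image of the standard simplex, a closed subset of the unit cube.
    Weights are taken as row vectors to use the compactness of the cube there. *)
Lemma polygon_compact : compact (polygon v).
Proof.
pose S := [set w : 'rV[R]_n | forall i, `[0, 1]%classic (w ord0 i)] `&`
          (comb (fun=> 1)) @^-1` [set 1].
have cC : compact [set w : 'rV[R]_n | forall i, `[0, 1]%classic (w ord0 i)].
  apply: (@rV_compact R n (fun=> `[0, 1]%classic)) => _.
  exact: segment_compact.
have cS : compact S.
  apply: compact_closedI; first exact: cC.
  by apply: closed_comp; [move=> w _; exact: comb_continuous|exact: closed_eq].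
have -> : polygon v = (fun w => (comb (fun i => (v i).1) w,
                                 comb (fun i => (v i).2) w)) @` S.
  apply/seteqP; split=> [p [w [w0 w1 ->]]|_ [w [w0 w1] <-]].
    exists (\row_i w i); last first.
      by congr (_, _); apply: eq_bigr => i _; rewrite mxE.
    split=> /= [i|].
      rewrite in_itv /= mxE w0 /= -w1 (bigD1 i) //= lerDl.
      by apply: sumr_ge0.
    by rewrite /comb -[RHS]w1; apply: eq_bigr => i _; rewrite mxE mulr1.
  exists (w ord0); split=> // [i|].
    by have := w0 i; rewrite /= in_itv /= => /andP[].
  by rewrite -[RHS]w1 /comb; apply: eq_bigr => i _; rewrite mulr1.
apply: continuous_compact => //; apply: continuous_subspaceT => w.
apply: (@cvg_pair _ _ _ (nbhs w) (nbhs (comb _ w)) (nbhs (comb _ w)));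
  exact: comb_continuous.
Qed.

Lemma polygon_convex (p q : R * R) (t : R) : 0 <= t <= 1 ->
  polygon v p -> polygon v q ->
  polygon v ((1 - t) * p.1 + t * q.1, (1 - t) * p.2 + t * q.2).
Proof.
move=> /andP[t0 t1] [w [w0 w1 ->]] [z [z0 z1 ->]] /=.
exists (fun i => (1 - t) * w i + t * z i); split.
- by move=> i; rewrite addr_ge0 ?mulr_ge0 ?subr_ge0.
- by rewrite big_split /= -!mulr_sumr w1 z1; ring.
- by congr (_, _); rewrite !mulr_sumr -big_split /=;
     apply: eq_bigr => i _; ring.
Qed.
End Polygon.

(** * The cyclic successor of indices *)

Lemma ordS_neq (n : nat) (i : 'I_n) : (1 < n)%N -> ordS i != i.
Proof.
move=> n1; apply/negP => /eqP /(congr1 val) /= /eqP.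
rewrite -{2}(modn_small (ltn_ord i)) -[X in X == _ %[mod n]]addn1.
by rewrite -[X in _ == X %[mod n]]addn0 eqn_modDl mod0n modn_small.
Qed.

Lemma ordSS_neq (n : nat) (i : 'I_n) : (2 < n)%N -> ordS (ordS i) != i.
Proof.
move=> n2; apply/negP => /eqP /(congr1 val) /= /eqP.
rewrite -{2}(modn_small (ltn_ord i)) -addn1 modnDml addn1.
rewrite -[X in X == _ %[mod n]]addn2.
by rewrite -[X in _ == X %[mod n]]addn0 eqn_modDl mod0n modn_small.
Qed.

(** Below [n - 1] the cyclic successor is the ordinary one, so an induction from 0 reaches every
    index without wrapping around. *)
Lemma const_of_ordS (T : Type) (n : nat) (F : 'I_n -> T) :
  (forall i, F (ordS i) = F i) -> forall i j, F i = F j.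
Proof.
move=> FS i0; have n0 : (0 < n)%N by exact: leq_trans (ltn_ord i0).
suff h : forall k (kn : (k < n)%N), F (Ordinal kn) = F (Ordinal n0).
  by case: i0 => i hi [j hj]; rewrite !h.
elim=> [|k IH] kn; first by congr F; exact: val_inj.
rewrite -(IH (ltnW kn)) -[RHS]FS; congr F; apply: val_inj => /=.
by rewrite modn_small.
Qed.

(** * Variation of a linear function along the boundary of a convex polygon *)

Section CyclicVariation.
Variables (R : realType) (n : nat) (v : 'I_n -> R * R).
Hypothesis cv : convex_polygon_vertices v.

Lemma cross_edge_ge0 (i j : 'I_n) :
  0 <= cross (vsub (v (ordS i)) (v i)) (vsub (v j) (v i)).
Proof.
have [->|ji] := eqVneq j i; first by rewrite /cross /vsub /=; lra.
have [->|jSi] := eqVneq j (ordS i); first by rewrite /cross /vsub /=; lra.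
by apply/ltW; case: cv => _; apply.
Qed.

Variable u : R * R.
Let F (i : 'I_n) : R := cross u (v i).

(* The vector from [v (ordS i)] to any vertex is a nonnegative combination of the
   two edges at [v (ordS i)]; hence a local extremum of [F] is global. *)
Lemma cross_vertex_cone (i j : 'I_n) : exists a b k : R,
  [/\ 0 < k, 0 <= a, 0 <= b,
      k * (F j - F (ordS i)) =
        a * (F (ordS (ordS i)) - F (ordS i)) + b * (F i - F (ordS i)) &
      a = 0 -> j = i \/ j = ordS i].
Proof.
(* Cramer's rule in the basis of the two edges at [v (ordS i)]; the determinant [k] is twice the
   area of the triangle of three consecutive vertices. If [a = 0], then [v j] is on the line of edge
   [i], which by strict convexity contains only its two ends. *)
exists (cross (vsub (v (ordS i)) (v i)) (vsub (v j) (v i))),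
  (cross (vsub (v (ordS (ordS i))) (v (ordS i))) (vsub (v j) (v (ordS i)))),
  (cross (vsub (v (ordS i)) (v i)) (vsub (v (ordS (ordS i))) (v i))).
split; try exact: cross_edge_ge0.
- by case: cv => n3; apply; [exact: ordSS_neq|apply/ordS_neq/ltnW].
- by rewrite /F /cross /vsub /=; ring.
move=> a0; have [->|ji] := eqVneq j i; first by left.
have [->|jSi] := eqVneq j (ordS i); first by right.
have [_ /(_ i j ji jSi)] := cv.
by rewrite a0 ltxx.
Qed.

(* [peak i] and [valley i] describe the vertex [ordS i]. *)
Let up (i : 'I_n) := F i <= F (ordS i).
Let peak (i : 'I_n) := up i && ~~ up (ordS i).
Let valley (i : 'I_n) := ~~ up i && up (ordS i).

Let peak_max (i j : 'I_n) : peak i -> F j <= F (ordS i).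
Proof.
rewrite /peak /up -ltNge => /andP[Fi FSi].
have [a [b [k [k0 a0 b0 e _]]]] := cross_vertex_cone i j.
by rewrite -subr_le0 -(pmulr_rle0 _ k0) e; nra.
Qed.

Let valley_min (i j : 'I_n) : valley i -> F (ordS i) <= F j.
Proof.
rewrite /valley /up -ltNge => /andP[Fi FSi].
have [a [b [k [k0 a0 b0 e _]]]] := cross_vertex_cone i j.
by rewrite -subr_ge0 -(pmulr_rge0 _ k0) e; nra.
Qed.

(** Both peaks have the maximal value, so the cone identity at [ordS i] has left side 0. The descent
    after a peak is strict, which forces [a = 0]; then [ordS j] is [i] or [ordS i], and the former
    contradicts the strict descent after [j]. *)
Let peak_unique (i j : 'I_n) : peak i -> peak j -> i = j.
Proof.
move=> pi pj.
have Fij : F (ordS j) = F (ordS i).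
  by apply/eqP; rewrite eq_le !peak_max.
have [a [b [k [k0 a0 b0 e a0P]]]] := cross_vertex_cone i (ordS j).
move: pi pj; rewrite /peak /up -!ltNge => /andP[Fi FSi] /andP[Fj FSj].
have {}a0 : a = 0 by nra.
case: (a0P a0) => [ji|/(can_inj (@ordSK n))//].
by move: FSj; rewrite ji ltNge Fi.
Qed.

(** Summation by parts: with each absolute value written as a sign times an increment, a vertex
    keeps its value of [F] times the jump of the sign. The jump is 2 at a peak, -2 at a valley and 0
    elsewhere. *)
Lemma sum_abs_cross_edges (a b : 'I_n) :
  (forall i, F i <= F a) -> (forall i, F b <= F i) ->
  \sum_(i < n) `|cross u (vsub (v (ordS i)) (v i))| = 2 * (F a - F b).
Proof.
move=> Fa Fb.
have -> : \sum_(i < n) `|cross u (vsub (v (ordS i)) (v i))|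
        = \sum_(i < n) `|F (ordS i) - F i|.
  by apply: eq_bigr => i _; congr `|_|; rewrite /F /cross /vsub /=; ring.
pose sg i : R := if up i then 1 else -1.
have sgS (G : 'I_n -> R) : \sum_i G (ordS i) = \sum_i G i.
  by rewrite [RHS](reindex_onto (@ordS n) (@ord_pred n)) /=;
     [apply: eq_bigl => i; rewrite ordSK eqxx|move=> i _; rewrite ord_predK].
have sumE : \sum_i `|F (ordS i) - F i| =
          \sum_i (sg i - sg (ordS i)) * F (ordS i).
  transitivity (\sum_i (sg i * F (ordS i) - sg i * F i)).
    apply: eq_bigr => i _; rewrite /sg /up -mulrBr.
    case: leP => h; first by rewrite mul1r ger0_norm // subr_ge0.
    by rewrite mulN1r ltr0_norm // subr_lt0.
  rewrite sumrB -(sgS (fun i => sg i * F i)) -sumrB.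
  by apply: eq_bigr => i _; rewrite mulrBl.
pose p : nat := \sum_i (peak i : nat).
pose q : nat := \sum_i (valley i : nat).
have sgE i : sg i - sg (ordS i) = 2 * (peak i)%:R - 2 * (valley i)%:R.
  by rewrite /sg /peak /valley; case: (up i); case: (up (ordS i)) => /=; lra.
(* The jumps of the sign cancel around the cycle, so there are as many valleys as peaks. *)
have pq : p%:R = q%:R :> R.
  have : \sum_i (sg i - sg (ordS i)) = 0 by rewrite sumrB sgS subrr.
  under eq_bigr do rewrite sgE.
  by rewrite sumrB -!mulr_sumr -!natr_sum -/p -/q; lra.
have pE : \sum_i (sg i - sg (ordS i)) * F (ordS i) = 2 * p%:R * (F a - F b).
  transitivity (\sum_i (2 * (peak i)%:R * F a - 2 * (valley i)%:R * F b)).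
    apply: eq_bigr => i _; rewrite sgE mulrBl; congr (_ - _).
      case: (boolP (peak i)) => [pi|]; last by rewrite !mulr0 !mul0r.
      by congr (_ * _); apply/eqP; rewrite eq_le Fa peak_max.
    case: (boolP (valley i)) => [pi|]; last by rewrite !mulr0 !mul0r.
    by congr (_ * _); apply/eqP; rewrite eq_le Fb valley_min.
  rewrite sumrB -!mulr_suml -!mulr_sumr -!natr_sum -/p -/q -pq; ring.
have p1 : (p <= 1)%N.
  rewrite /p -big_mkcond /= sum1_card; apply/card_le1_eqP => i j pi pj.
  exact: peak_unique.
(* One peak gives the claim at once. With no peak the sum is 0, so every increment vanishes, [F] is
   constant, and both sides are 0. *)
move: (p) p1 pE sumE => [|[|//]] _ -> sumE; last by rewrite sumE mulr1.
have /psumr_eq0P h : \sum_i `|F (ordS i) - F i| = 0.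
  by rewrite sumE mulr0 mul0r.
rewrite (const_of_ordS (F := F) _ a b) ?subrr ?sumE.
  by rewrite mulr0 mul0r.
by move=> i; apply/eqP; rewrite -subr_eq0 -normr_eq0 h.
Qed.
End CyclicVariation.

(** * Lengths of swept slices, and areas and volumes as integrals of slices *)

Section Slices.
Variable R : realType.
Notation mu := (@lebesgue_measure R).
Local Open Scope ereal_scope.

(** The pushforward by a translation agrees with [mu] on half-open intervals, which determine the
    measure. *)
Lemma lebesgue_measure_translate (k : R) (A : set R) : measurable A ->
  mu [set y | A (y + k)%R] = mu A.
Proof.
move=> mA; have mk : measurable_fun setT (fun y : R => (y + k)%R).
  by apply: measurable_funD => //; exact: measurable_cst.
apply/esym.
rewrite (@lebesgue_measure_unique _ (pushforward mu
  ((fun y : R => (y + k)%R) : measurableTypeR R -> measurableTypeR R))) //=.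
move=> _ [[a b]] _ <-; rewrite /pushforward.
have -> : (fun y => (y + k)%R) @^-1` `]a, b]%classic =
          `](a - k)%R, (b - k)%R]%classic.
  by apply/seteqP; split => x /=; rewrite !in_itv /=; lra.
rewrite /= !lebesgue_measure_itv /= !lte_fin ltrD2r.
by case: ifP => // _; rewrite -!EFinB; congr EFin; ring.
Qed.

Lemma compact_interval_itvcc (J : set R) : compact J -> is_interval J ->
  J !=set0 -> exists a b : R, (a <= b)%R /\ J = `[a, b]%classic.
Proof.
move=> cJ iJ J0.
have cid : {within J, continuous (@id R)} by apply: continuous_subspaceT => x.
have [b /set_mem Jb bmax] := compact_EVT_max J0 cJ cid.
have [a /set_mem Ja amin] := compact_EVT_min J0 cJ cid.
exists a, b; split; first exact/amin/mem_set.
apply/seteqP; split => x /=; rewrite in_itv /=; last exact: iJ.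
by move=> /mem_set Jx; rewrite amin // bmax.
Qed.

Lemma lebesgue_measure_itvcc (x y : R) : (x <= y)%R ->
  mu `[x, y]%classic = (y - x)%:E.
Proof.
rewrite lebesgue_measure_itv /= lte_fin => xy.
by case: ltP => // yx; congr EFin; lra.
Qed.

(** If [J] is [[a, b]], the swept set is [[a - r c, b]] or [[a, b - r c]] according to the sign of
    [c]. *)
Lemma measure_swept_interval (J : set R) (r c : R) : (0 <= r)%R ->
  compact J -> is_interval J -> J !=set0 ->
  mu [set x | exists t, (0 <= t <= r)%R /\ J (x + t * c)%R] =
  mu J + (r * `|c|)%:E.
Proof.
move=> r0 cJ iJ J0.
have [a [b [ab ->]]] := compact_interval_itvcc cJ iJ J0.
rewrite (lebesgue_measure_itvcc ab) -EFinD.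
have [c0|c0] := leP 0%R c.
  rewrite [X in mu X](_ : _ = `[(a - r * c)%R, b]%classic).
    by rewrite lebesgue_measure_itvcc ?ger0_norm //; [congr EFin; ring|nra].
  apply/seteqP; split => x /=; rewrite in_itv /=.
    move=> [t [/andP[t0 tr]]]; rewrite in_itv /= => /andP[? ?].
    by apply/andP; split; nra.
  move=> /andP[ax xb].
  have [xa|xa] := leP a x.
    by exists 0%R; rewrite lexx r0 in_itv /= mul0r addr0 xa xb.
  have cp : (0 < c)%R by nra.
  (* This time carries [x] exactly to the endpoint [a]. *)
  exists ((a - x) / c)%R; rewrite divr_ge0 ?subr_ge0 ?(ltW xa) ?(ltW cp) //=.
  rewrite ler_pdivrMr // in_itv /= divfK ?gt_eqF //.
  rewrite (_ : x + (a - x) = a)%R; last ring.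
  by rewrite lexx ab; split => //; lra.
rewrite [X in mu X](_ : _ = `[a, (b - r * c)%R]%classic).
  by rewrite lebesgue_measure_itvcc ?ltr0_norm //; [congr EFin; ring|nra].
apply/seteqP; split => x /=; rewrite in_itv /=.
  move=> [t [/andP[t0 tr]]]; rewrite in_itv /= => /andP[? ?].
  by apply/andP; split; nra.
move=> /andP[ax xb].
have [xa|xa] := leP x b.
  by exists 0%R; rewrite lexx r0 in_itv /= mul0r addr0 xa ax.
have cp : (0 < - c)%R by rewrite oppr_gt0.
exists ((x - b) / - c)%R; rewrite divr_ge0 ?subr_ge0 ?(ltW xa) ?(ltW cp) //=.
rewrite ler_pdivrMr // in_itv /=.
rewrite (_ : x + (x - b) / - c * c = b)%R; last by field; rewrite lt_eqF.
by rewrite lexx ab; split => //; lra.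
Qed.

Lemma measure_scaled_segment (A B c : R) : (A <= B)%R -> c != 0%R ->
  measurable [set y | (A <= c * y <= B)%R] /\
  mu [set y | (A <= c * y <= B)%R] = ((B - A) / `|c|)%:E.
Proof.
move=> AB c0.
have cc (x y : R) : (x <= y)%R ->
    measurable `[x, y]%classic /\ mu `[x, y]%classic = (y - x)%:E.
  move=> xy; split; first exact: measurable_itv.
  exact: lebesgue_measure_itvcc.
have [cp|cn] := ltP 0%R c.
  rewrite (_ : [set y | _] = `[(A / c)%R, (B / c)%R]%classic).
    by rewrite gtr0_norm // mulrBl; apply: cc; rewrite ler_pM2r ?invr_gt0.
  by apply/seteqP; split => x /=;
     rewrite in_itv /= ler_pdivrMr // ler_pdivlMr // ![(_ * c)%R]mulrC.
have {}cn : (c < 0)%R by rewrite lt_neqAle c0.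
rewrite (_ : [set y | _] = `[(B / c)%R, (A / c)%R]%classic).
  have BA : (B / c <= A / c)%R by rewrite ler_nM2r ?invr_lt0.
  have [? ->] := cc _ _ BA.
  split => //; congr EFin.
  by rewrite ltr0_norm // invrN mulrN -mulNr opprB mulrBl.
by apply/seteqP; split => x /=;
   rewrite in_itv /= ler_ndivrMr // ler_ndivlMr // ![(_ * c)%R]mulrC andbC.
Qed.

(** The product measure is defined by slices in the other direction; its uniqueness allows the
    exchange. *)
Lemma leb2_ysection (A : set (R * R)) : measurable A ->
  leb2 A = \int[mu]_y mu (ysection A y).
Proof.
move=> mA.
exact: (product_measure_unique (m' := (mu \x^ mu)%E)
  (@product_measure2E _ _ _ _ _ mu mu)).
Qed.

Lemma leb2_xsection (A : set (R * R)) : leb2 A = \int[mu]_x mu (xsection A x).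
Proof. by []. Qed.

(* The library's instance on [\x] only covers products of subprobability
   measures, hence this one keyed on [leb2]. *)
HB.instance Definition _ := Measure.on (@leb2 R).

(** Squares of an increasing exhaustion of the line exhaust the plane. Slicing [leb3] by direction
    relies on this. *)
Let leb2_sigma_finite : sigma_finite setT (@leb2 R).
Proof.
have /sigma_finiteP[F [TF ndF Foo]] := sigma_finiteT mu.
exists (fun n => F n `*` F n).
  rewrite -setXTT TF predeqE => -[x y]; split => [[/= [n _ Fx] [k _ Fy]]|].
    exists (maxn n k) => //; split => /=.
    - by move: x Fx; exact/subsetPset/ndF/leq_maxl.
    - by move: y Fy; exact/subsetPset/ndF/leq_maxr.
  by move=> [n _ [/= ? ?]]; split; exists n.
move=> k; have [? ?] := Foo k; split; first exact: measurableX.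
by rewrite /leb2 product_measure1E // lte_mul_pinfty // ge0_fin_numE.
Qed.

HB.instance Definition _ := Measure_isSigmaFinite.Build _ _ _ (@leb2 R)
  leb2_sigma_finite.

Lemma leb3_ysection (A : set (R * R * R)) : measurable A ->
  leb3 A = \int[mu]_th leb2 (ysection A th).
Proof.
move=> mA.
exact: (product_measure_unique (m1 := @leb2 R) (m' := ((@leb2 R) \x^ mu)%E)
  (@product_measure2E _ _ _ _ _ (@leb2 R) mu)).
Qed.

(** Meant for [f] and [g] the slice lengths of the sweep and of the target, with [P] the set of
    lines that meet the target. *)
Lemma integral_add_indic (f g : R -> \bar R) (P : set R) (k : R) :
  measurable P -> (0 <= k)%R -> measurable_fun setT g -> (forall y, 0 <= g y) ->
  (forall y, P y -> f y = g y + k%:E) -> (forall y, ~ P y -> f y = g y) ->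
  \int[mu]_y f y = \int[mu]_y g y + k%:E * mu P.
Proof.
move=> mP k0 mg g0 fP fnP.
transitivity (\int[mu]_y (g y + k%:E * (\1_P y)%:E)).
  apply: eq_integral => y _; rewrite indicE.
  have [/set_mem Py|/negP nPy] := boolP (y \in P).
    by rewrite mule1 fP.
  by rewrite mule0 adde0 fnP // => Py; apply: nPy; exact: mem_set.
rewrite ge0_integralD //; last 2 first.
- by move=> y _; rewrite -EFinM lee_fin mulr_ge0.
- by apply: measurable_funeM; exact/measurable_EFinP.
rewrite ge0_integralZl //; last exact/measurable_EFinP.
by rewrite integral_indic // setIT.
Qed.

Lemma measurable_shear (k : R) (A : set (R * R)) : measurable A ->
  measurable [set p | A (p.1, (p.2 + k * p.1)%R)].
Proof.
move=> mA.
have mf : measurable_fun setT (fun p : R * R => (p.1, (p.2 + k * p.1)%R)).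
  apply: measurable_fun_pair => //=.
  by apply: measurable_funD => //; apply: measurable_funM.
by rewrite -[X in measurable X]setTI; exact: mf.
Qed.

(** The shear acts on each vertical line as a translation. *)
Lemma leb2_shear (k : R) (A : set (R * R)) : measurable A ->
  leb2 [set p | A (p.1, (p.2 + k * p.1)%R)] = leb2 A.
Proof.
move=> mA; rewrite !leb2_xsection; apply: eq_integral => x _.
have mAx : measurable (xsection A x) by exact: measurable_xsection.
rewrite -[RHS](lebesgue_measure_translate (k * x)%R mAx).
by congr (mu _); apply/seteqP; split => y /= /xsectionP h; apply/xsectionP.
Qed.

End Slices.

(** * Area swept by a compact convex set moved along a direction *)

Section Sweep.
Variable R : realType.
Notation mu := (@lebesgue_measure R).

Definition sweep (K : set (R * R)) (u : R * R) (r : R) : set (R * R) :=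
  [set p | exists t, 0 <= t <= r /\ K (p.1 + t * u.1, p.2 + t * u.2)].

Definition convex_in_plane (K : set (R * R)) := forall p q t, 0 <= t <= 1 ->
  K p -> K q -> K ((1 - t) * p.1 + t * q.1, (1 - t) * p.2 + t * q.2).

Lemma level_compact (K : set (R * R)) (l g : R * R -> R) (y : R) :
  compact K -> continuous l -> continuous g ->
  compact (g @` (K `&` l @^-1` [set y])).
Proof.
move=> cK cl cg; apply: continuous_compact; first exact: continuous_subspaceT.
apply: compact_closedI => //.
by apply: closed_comp; [move=> p _; exact: cl|exact: closed_eq].
Qed.

Lemma interval_of_segment (J : set R) :
  (forall x y t, 0 <= t <= 1 -> J x -> J y -> J ((1 - t) * x + t * y)) ->
  is_interval J.
Proof.
move=> cJ x y Jx Jy z /andP[xz zy].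
have [yx|xy] := leP y x.
  by rewrite (_ : z = x) //; apply/eqP; rewrite eq_le xz (le_trans zy).
have yx : 0 < y - x by rewrite subr_gt0.
have -> : z = (1 - (z - x) / (y - x)) * x + (z - x) / (y - x) * y.
  by field; rewrite gt_eqF.
apply: cJ => //; rewrite divr_ge0 ?subr_ge0 //=; last by lra.
by rewrite ler_pdivrMr // mul1r lerD2r.
Qed.

Section SweepArea.
Variables (K : set (R * R)) (u a b : R * R) (r : R).
Hypotheses (cK : compact K) (kK : convex_in_plane K) (r0 : 0 <= r).
Hypotheses (Ka : K a) (Kb : K b).
Hypothesis aKb : forall p, K p -> cross u a <= cross u p <= cross u b.
Hypothesis mS : measurable (sweep K u r).

Let mK : measurable K. Proof. exact: compact_measurable2. Qed.

(** A linear function maps a convex set onto an interval, whose ends are here attained at [a] and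
    [b]. *)
Let crossP (z : R) :
  (exists2 p, K p & cross u p = z) <-> cross u a <= z <= cross u b.
Proof.
split=> [[p Kp <-]|zab]; first exact: aKb.
have : is_interval [set z | exists2 p, K p & cross u p = z].
  apply: interval_of_segment => _ _ t t01 [p Kp <-] [q Kq <-].
  exists ((1 - t) * p.1 + t * q.1, (1 - t) * p.2 + t * q.2); first exact: kK.
  by rewrite /cross /=; ring.
by move=> /(_ (cross u a) (cross u b)); apply => //; [exists a|exists b].
Qed.

Let ab : cross u a <= cross u b.
Proof. by have /andP[] := aKb Ka. Qed.

(** A shear of slope [k] makes [u] horizontal, so that the sweep acts inside the horizontal slices
    and lengthens each nonempty one by [r * |u.1|]. *)
Let sweep_area_oblique : u.1 != 0 ->
  (leb2 (sweep K u r) = leb2 K + (r * (cross u b - cross u a))%:E)%E.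
Proof.
move=> c0; pose k := u.2 / u.1.
rewrite -(leb2_shear k mS) -[in RHS](leb2_shear k mK).
rewrite !leb2_ysection; [|exact: measurable_shear..].
(* On the line of slope [k] through [(0, y)], [cross u] is constantly [u.1 * y]. Hence [P] has
   length [(cross u b - cross u a) / |u.1|], and the factor [|u.1|] cancels in the end. *)
pose P := [set y | cross u a <= u.1 * y <= cross u b].
have [mP muP] := measure_scaled_segment ab c0.
have PE y : P y <-> exists x, K (x, y + k * x).
  rewrite /P /= -crossP; split=> [[p Kp pE]|[x Kx]].
    exists p.1; rewrite (_ : y + k * p.1 = p.2) -?surjective_pairing //.
    apply: (mulfI c0); rewrite mulrDr -pE /cross /k; field.
    by [].
  exists (x, y + k * x) => //; rewrite /cross /k /=; field.
  by [].
rewrite (@integral_add_indic _ _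
  (fun y => mu (ysection [set p | K (p.1, p.2 + k * p.1)] y)) P (r * `|u.1|) mP).
- rewrite muP -EFinM; congr (_ + _%:E)%E.
  by rewrite -mulrA; congr (r * _); rewrite mulrC divfK // normr_eq0.
- by rewrite mulr_ge0.
- by apply: measurable_fun_ysection; exact: measurable_shear.
- by [].
- move=> y /PE[x0 Kx0].
  have JE : ysection [set p | K (p.1, p.2 + k * p.1)] y =
      (fun p => p.1) @` (K `&` (fun p => p.2 - k * p.1) @^-1` [set y]).
    apply/seteqP; split=> x /=.
      move=> /ysectionP /= Kx; exists (x, y + k * x) => //.
      by split => //=; ring.
    move=> [p [Kp /= py] <-]; apply/ysectionP => /=.
    by rewrite -py subrK -surjective_pairing.
  rewrite -measure_swept_interval //.
  + congr (mu _); apply/seteqP; split => x /=.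
      move=> /ysectionP /= [t [t0 Kt]]; exists t; split => //.
      apply/ysectionP => /=.
      rewrite (_ : y + k * (x + t * u.1) = y + k * x + t * u.2) //.
      by rewrite /k; field.
    move=> [t [t0 /ysectionP /= Kt]]; apply/ysectionP => /=.
    exists t; split => //=.
    rewrite (_ : y + k * x + t * u.2 = y + k * (x + t * u.1)) //.
    by rewrite /k; field.
  + rewrite JE; apply: level_compact => // p.
      apply: (@cvgB _ _ _ (nbhs p)); first exact: cvg_snd.
      by apply: (@cvgM _ _ (nbhs p)); [exact: cvg_cst|exact: cvg_fst].
    exact: cvg_fst.
  + apply: interval_of_segment => x z t t01 /ysectionP /= Kx /ysectionP /= Kz.
    apply/ysectionP => /=.
    have := kK t01 Kx Kz; rewrite /=.
    by congr (K (_, _)); ring.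
  + by exists x0; apply/ysectionP.
(* A line that misses [K] is not entered by the sweep either, since the motion stays on the line:
   both slices are empty. *)
- move=> y nPy.
  have K0 : ysection [set p | K (p.1, p.2 + k * p.1)] y = set0.
    apply/seteqP; split=> // x /ysectionP /= Kx.
    by apply: nPy; apply/PE; exists x.
  rewrite K0; congr (mu _).
  apply/seteqP; split=> // x /ysectionP /= [t [_ Kt]]; apply: nPy; apply/PE.
  exists (x + t * u.1); rewrite (_ : y + _ = y + k * x + t * u.2) //.
  by rewrite /k; field.
Qed.

(** Here the vertical slices are swept directly, with no shear, and [cross u p] is [- u.2 * p.1]. *)
Let sweep_area_vertical : u.1 = 0 -> u.2 != 0 ->
  (leb2 (sweep K u r) = leb2 K + (r * (cross u b - cross u a))%:E)%E.
Proof.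
move=> c0 s0; have s0' : - u.2 != 0 by rewrite oppr_eq0.
rewrite !leb2_xsection.
pose P := [set y | cross u a <= - u.2 * y <= cross u b].
have [mP muP] := measure_scaled_segment ab s0'.
have PE x : P x <-> exists y, K (x, y).
  rewrite /P /= -crossP; split=> [[p Kp pE]|[y Kx]].
    exists p.2; rewrite (_ : x = p.1) -?surjective_pairing //.
    by apply: (mulfI s0'); rewrite -pE /cross c0; ring.
  by exists (x, y) => //; rewrite /cross c0 /=; ring.
rewrite (@integral_add_indic _ _ (fun x => mu (xsection K x)) P
  (r * `|u.2|) mP).
- rewrite muP normrN -EFinM; congr (_ + _%:E)%E.
  by rewrite -mulrA; congr (r * _); rewrite mulrC divfK // normr_eq0.
- by rewrite mulr_ge0.
- exact: measurable_fun_xsection.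
- by [].
- move=> x /PE[y0 Ky0].
  have JE : xsection K x =
      (fun p => p.2) @` (K `&` (fun p => p.1) @^-1` [set x]).
    apply/seteqP; split=> y /=.
      by move=> /xsectionP /= Kx; exists (x, y).
    by move=> [p [Kp /= <-] <-]; apply/xsectionP; rewrite -surjective_pairing.
  rewrite -measure_swept_interval //.
  + congr (mu _); apply/seteqP; split => y /=.
      move=> /xsectionP /= [t [t0]]; rewrite /= c0 mulr0 addr0 => Kt.
      by exists t; split => //; apply/xsectionP.
    move=> [t [t0 /xsectionP /= Kt]]; apply/xsectionP => /=.
    exists t; split => //=.
    by rewrite c0 mulr0 addr0.
  + by rewrite JE; apply: level_compact => // p; [exact: cvg_fst|exact: cvg_snd].
  + apply: interval_of_segment => y z t t01 /xsectionP /= Ky /xsectionP /= Kz.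
    apply/xsectionP => /=.
    have := kK t01 Ky Kz; rewrite /=.
    by congr (K (_, _)); ring.
  + by exists y0; apply/xsectionP.
- move=> x nPx.
  have K0 : xsection K x = set0.
    apply/seteqP; split=> // y /xsectionP /= Kx.
    by apply: nPx; apply/PE; exists y.
  rewrite K0; congr (mu _).
  apply/seteqP; split=> // y /xsectionP /= [t [_ Kt]]; apply: nPx; apply/PE.
  by exists (y + t * u.2); move: Kt; rewrite /= c0 mulr0 addr0.
Qed.

Lemma sweep_area : u != (0, 0) ->
  (leb2 (sweep K u r) = leb2 K + (r * (cross u b - cross u a))%:E)%E.
Proof.
have [c0 u0|c0 _] := eqVneq u.1 0; last exact: sweep_area_oblique.
apply: sweep_area_vertical => //; apply: contra u0 => /eqP s0.
by rewrite [u]surjective_pairing c0 s0.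
Qed.

End SweepArea.
End Sweep.

(** * Integrals of absolute sines and cross products over a full turn *)

Section AbsSinIntegral.
Variable R : realType.
Notation mu := (@lebesgue_measure R).

Lemma is_derive_cos_shift (s phi x : R) :
  is_derive x (1:R) (fun y => - s * cos (y - phi)) (s * sin (x - phi)).
Proof.
apply: is_derive_eq.
by rewrite /GRing.scale /=; ring.
Qed.

Lemma continuous_sin_shift1 (phi : R) : continuous (fun x => sin (x - phi)).
Proof.
move=> x; apply: continuous_comp; last exact: continuous_sin.
by apply: cvgB; [exact: cvg_id|exact: cvg_cst].
Qed.

Lemma continuous_sin_shift (s phi : R) : continuous (fun x => s * sin (x - phi)).
Proof.
by move=> x; apply: cvgM; [exact: cvg_cst|exact: continuous_sin_shift1].
Qed.

Lemma integral_abs_sin_piece (s phi a b : R) : a <= b ->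
  (forall x, a <= x <= b -> `|sin (x - phi)| = s * sin (x - phi)) ->
  (\int[mu]_(x in `[a, b[) (`|sin (x - phi)|)%:E =
    (s * (cos (a - phi) - cos (b - phi)))%:E)%E.
Proof.
rewrite le_eqVlt => /predU1P[<- _|ab abs].
  by rewrite set_itvco0 integral_set0 subrr mulr0.
transitivity (\int[mu]_(x in `[a, b[) (s * sin (x - phi))%:E)%E.
  apply: eq_integral => x; rewrite inE /= in_itv /= => /andP[ax xb].
  by rewrite abs // ax ltW.
(* Half-open pieces glue without overlap, while the fundamental theorem of calculus is applied on
   the closed interval; they differ by a null set. *)
rewrite integral_itv_bndo_bndc; last first.
  apply/measurable_EFinP; apply: measurable_funTS.
  apply: continuous_measurable_fun; exact: continuous_sin_shift.
rewrite (@continuous_FTC2 _ _ (fun y => - s * cos (y - phi))) //.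
- by rewrite -EFinB; congr EFin; ring.
- exact/continuous_subspaceT/continuous_sin_shift.
- have dF x : derivable (fun y => - s * cos (y - phi)) x 1.
    by have [] := is_derive_cos_shift s phi x.
  have cF : continuous (fun y => - s * cos (y - phi)).
    by move=> x; apply/differentiable_continuous/derivable1_diffP.
  split=> //.
    by apply: cvg_at_right_filter; exact: cF.
  by apply: cvg_at_left_filter; exact: cF.
- by move=> x _; rewrite derive1E; have [_ ->] := is_derive_cos_shift s phi x.
Qed.

(** The cuts at [phi] and [phi + pi] lie in the range because [phi] is in [[0, pi]]. The three
    pieces contribute [1 - cos phi], [2] and [1 + cos phi]. *)
Lemma integral_abs_sin (phi : R) : 0 <= phi <= pi ->
  (\int[mu]_(x in `[0%R, (2 * pi)%R[) (`|sin (x - phi)|)%:E = 4%:E)%E.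
Proof.
move=> /andP[phi0 phipi]; have pi0 := pi_ge0 R.
have mf (D : set R) : measurable D ->
    measurable_fun D (fun x => (`|sin (x - phi)|)%:E).
  move=> mD; apply/measurable_EFinP/measurable_funTS.
  apply: measurableT_comp => //; apply: continuous_measurable_fun.
  exact: continuous_sin_shift1.
have split_at (a b c : R) : a <= c <= b ->
    (\int[mu]_(x in `[a, b[) (`|sin (x - phi)|)%:E =
     \int[mu]_(x in `[a, c[) (`|sin (x - phi)|)%:E +
     \int[mu]_(x in `[c, b[) (`|sin (x - phi)|)%:E)%E.
  move=> /andP[ac cb].
  rewrite (@itv_bndbnd_setU _ _ _ (BLeft c)) ?bnd_simp //.
  rewrite ge0_integral_setU //; first by apply: mf; exact: measurableU.
  by apply/disj_setPS => x [] /=; rewrite !in_itv /=; lra.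
rewrite (split_at _ _ phi); last by apply/andP; split; lra.
rewrite (split_at phi _ (phi + pi)); last by apply/andP; split; lra.
rewrite (integral_abs_sin_piece (s := -1)) //; last first.
  move=> x /andP[x0 xphi].
  rewrite -normrN mulN1r -sinN opprB ger0_norm // sin_ge0_pi //.
  by lra.
rewrite (integral_abs_sin_piece (s := 1)) //; last 2 first.
- by lra.
- move=> x /andP[x0 xphi]; rewrite mul1r ger0_norm // sin_ge0_pi //. lra.
rewrite (integral_abs_sin_piece (s := -1)) //; last 2 first.
- by lra.
- move=> x /andP[x0 xphi].
  rewrite (_ : x - phi = (x - phi - pi) + pi); last by ring.
  rewrite sinDpi normrN mulrNN mul1r ger0_norm // sin_ge0_pi //.
  by lra.
rewrite -!EFinD; congr EFin.
rewrite sub0r subrr addrAC subrr add0r cos0 cospi.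
have -> : cos (2 * pi - phi) = cos (- phi).
  by rewrite addrC mulr2n mulrDl !mul1r addrA !cosDpi opprK.
by lra.
Qed.

(** In polar coordinates [e = d (cos phi, sin phi)], the cross product is [- d sin (x - phi)]. *)
Lemma integral_abs_cross (e : R * R) :
  (\int[mu]_(x in `[0%R, (2 * pi)%R[) (`|cross (cos x, sin x) e|)%:E
   = (4 * Num.sqrt (e.1 ^+ 2 + e.2 ^+ 2))%:E)%E.
Proof.
(* Negating [e] changes neither side, and [0 <= e.2] lets the polar angle be chosen in [[0, pi]],
   the range of [acos]. *)
wlog e2 : e / 0 <= e.2.
  move=> h; have [|/ltW e2] := leP 0 e.2; first exact: h.
  rewrite -[in RHS](sqrrN e.1) -[in RHS](sqrrN e.2).
  rewrite -(h (- e.1, - e.2)) /= ?oppr_ge0 //.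
  apply: eq_integral => x _; rewrite -normrN; congr (`|_|%:E).
  by rewrite /cross /=; ring.
set d := Num.sqrt _.
have d2 : d ^+ 2 = e.1 ^+ 2 + e.2 ^+ 2.
  by rewrite sqr_sqrtr // addr_ge0 // sqr_ge0.
have d0 : 0 <= d by exact: sqrtr_ge0.
have [phi [hphi e1E e2E]] : exists phi,
    [/\ 0 <= phi <= pi, e.1 = d * cos phi & e.2 = d * sin phi].
  move: d0; rewrite le_eqVlt => /predU1P[d0|dp].
    exists 0; rewrite lexx pi_ge0 -d0 !mul0r; split=> //.
      by apply/eqP; rewrite -sqrf_eq0; apply/eqP; move: d2; rewrite -d0; nra.
    by apply/eqP; rewrite -sqrf_eq0; apply/eqP; move: d2; rewrite -d0; nra.
  have h1 : -1 <= e.1 / d <= 1.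
    have : e.1 ^+ 2 <= d ^+ 2 by rewrite d2 lerDl sqr_ge0.
    rewrite ler_pdivlMr // ler_pdivrMr // mulN1r mul1r => ?.
    by apply/andP; split; nra.
  exists (acos (e.1 / d)); rewrite acos_ge0 // acos_lepi // acosK ?in_itv //.
  rewrite mulrC divfK ?gt_eqF //; split=> //.
  rewrite sin_acos //.
  have -> : 1 - (e.1 / d) ^+ 2 = (e.2 / d) ^+ 2.
    rewrite !expr_div_n -[1](@divff _ (d ^+ 2)) ?expf_neq0 ?gt_eqF //.
    by rewrite -mulrBl d2 addrAC subrr add0r.
  rewrite sqrtr_sqr ger0_norm ?divr_ge0 ?(ltW dp) //.
  by rewrite mulrC divfK ?gt_eqF.
transitivity
  (\int[mu]_(x in `[0%R, (2 * pi)%R[) (d%:E * (`|sin (x - phi)|)%:E))%E.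
  apply: eq_integral => x _; rewrite -EFinM; congr EFin.
  rewrite -[in RHS](ger0_norm d0) -normrM -normrN; congr `|_|.
  by rewrite sinB /cross /= e1E e2E; ring.
rewrite ge0_integralZl //; last first.
  apply/measurable_EFinP/measurable_funTS.
  apply: measurableT_comp => //; apply: continuous_measurable_fun.
  exact: continuous_sin_shift1.
by rewrite integral_abs_sin // -EFinM mulrC.
Qed.
End AbsSinIntegral.

(** * Measurability of the detection event *)

Section SweptEvent.
Variable R : realType.

(** The sensor ranges over the whole plane and [r] is not capped by [rmax]; both restrictions are
    restored in [hit_swept_event]. *)
Definition swept_event (T : set (R * R)) (r : R) : set (R * R * R) :=
  [set z | 0 <= z.2 < 2 * pi /\ sweep T (cos z.2, sin z.2) r z.1].

Lemma measurable_swept_event (T : set (R * R)) (r : R) : compact T ->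
  measurable (swept_event T r).
Proof.
move=> cT.
(* From a point of [T], a distance and a direction, [g] recovers the sensor. The image of the
   compact domain is compact; the closed range of directions is then cut back to the half-open
   one. *)
pose g (z : R * R * R * R) : R * R * R :=
  (z.1.1.1 - z.1.2 * cos z.2, z.1.1.2 - z.1.2 * sin z.2, z.2).
have -> : swept_event T r =
    g @` (T `*` `[0, r]%classic `*` `[0, 2 * pi]%classic) `&`
    (setT `*` `[0, 2 * pi[%classic).
  apply/seteqP; split=> [[[x y] th]|].
    move=> [/= /andP[th0 th2] [t [t0r /= Tt]]]; split; last first.
      by split => //=; rewrite in_itv /= th0 th2.
    exists ((x + t * cos th, y + t * sin th), t, th).
      by split => /=; [split|]; rewrite //= ?in_itv //= th0 ltW.
    by rewrite /g /= !addrK.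
  move=> _ [[[[[x y] t] th] [[/= Txy t0r] _] <-] [_ /= th2]].
  move: t0r th2; rewrite !in_itv /= => t0r th2; split => //=.
  by exists t; split => //=; rewrite !subrK.
apply: measurableI; last by apply: measurableX => //; exact: measurable_itv.
apply: compact_measurable3; apply: continuous_compact; last first.
  by apply: compact_setX; [apply: compact_setX => //|]; exact: segment_compact.
apply: continuous_subspaceT => z.
have c11 : continuous (fun w : R * R * R * R => w.1.1).
  by move=> w; apply: (@continuous_comp _ _ _ fst fst); exact: cvg_fst.
have cx : continuous (fun w : R * R * R * R => w.1.1.1).
  move=> w; apply: (@continuous_comp _ _ _ (fun w : R * R * R * R => w.1.1) fst).
    exact: c11.
  exact: cvg_fst.
have cy : continuous (fun w : R * R * R * R => w.1.1.2).
  move=> w; apply: (@continuous_comp _ _ _ (fun w : R * R * R * R => w.1.1) snd).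
    exact: c11.
  exact: cvg_snd.
have ct : continuous (fun w : R * R * R * R => w.1.2).
  move=> w; apply: (@continuous_comp _ _ _ fst snd).
    exact: cvg_fst.
  exact: cvg_snd.
have cc : continuous (fun w : R * R * R * R => cos w.2).
  move=> w; apply: (@continuous_comp _ _ _ snd cos); first exact: cvg_snd.
  exact: continuous_cos.
have cs : continuous (fun w : R * R * R * R => sin w.2).
  move=> w; apply: (@continuous_comp _ _ _ snd sin); first exact: cvg_snd.
  exact: continuous_sin.
apply: (@cvg_pair _ _ _ (nbhs z) (nbhs _) (nbhs _)
  _ _ _ _ _ _ (@cvg_snd _ _ _ _ _)).
apply: (@cvg_pair _ _ _ (nbhs z) (nbhs (_ : R)) (nbhs (_ : R))).
  apply: (@cvgB _ _ _ (nbhs z)); first exact: cx.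
  by apply: (@cvgM _ _ (nbhs z)); [exact: ct|exact: cc].
apply: (@cvgB _ _ _ (nbhs z)); first exact: cy.
by apply: (@cvgM _ _ (nbhs z)); [exact: ct|exact: cs].
Qed.

End SweptEvent.

(** * Cauchy's formula for the detection event of a convex polygon *)

Section Target.
Variables (R : realType) (n : nat) (v : 'I_n -> R * R).
Notation mu := (@lebesgue_measure R).

Lemma polygon_vertex (i : 'I_n) : polygon v (v i).
Proof.
exists (fun j => (j == i)%:R); split; first by move=> j; exact: ler0n.
  by rewrite (bigD1 i) //= eqxx big1 ?addr0 // => j /negbTE ->.
rewrite [LHS]surjective_pairing; congr (_, _);
  rewrite (bigD1 i) //= eqxx mul1r big1 ?addr0 // => j /negbTE ->;
  exact: mul0r.
Qed.

(** The value at [p] is a weighted mean of the values at the vertices. *)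
Lemma cross_polygon_le (u p : R * R) (a b : 'I_n) :
  (forall i, cross u (v a) <= cross u (v i) <= cross u (v b)) -> polygon v p ->
  cross u (v a) <= cross u p <= cross u (v b).
Proof.
move=> ab [w [w0 w1 ->]].
have -> : cross u (\sum_(i < n) w i * (v i).1, \sum_(i < n) w i * (v i).2) =
          \sum_(i < n) w i * cross u (v i).
  rewrite /cross /= !mulr_sumr -sumrB; apply: eq_bigr => i _; ring.
rewrite -[X in X <= _]mul1r -[X in _ <= _ <= X]mul1r -w1 !mulr_suml.
by apply/andP; split; apply: ler_sum => i _; apply: ler_wpM2l => //;
  have /andP[] := ab i.
Qed.

Hypothesis cv : convex_polygon_vertices v.

(** The width is written as a sum over edges so that the integral over directions can be taken edge
    by edge. *)
Lemma sweep_polygon_area (u : R * R) (r : R) : 0 <= r -> u != (0, 0) ->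
  measurable (sweep (polygon v) u r) ->
  (leb2 (sweep (polygon v) u r) = leb2 (polygon v) +
   \sum_(i < n) (r / 2)%:E * (`|cross u (vsub (v (ordS i)) (v i))|)%:E)%E.
Proof.
move=> r0 u0 mS; have n0 : (0 < n)%N by case: cv => n3 _; exact: leq_trans n3.
pose F i := cross u (v i).
have [b _ bmax] : exists2 b, true & forall i, F i <= F b.
  case: (@arg_maxP _ _ _ (Ordinal n0) xpredT F isT) => b _ h.
  by exists b => // i; exact: h.
have [a _ amin] : exists2 a, true & forall i, F a <= F i.
  case: (@arg_minP _ _ _ (Ordinal n0) xpredT F isT) => a _ h.
  by exists a => // i; exact: h.
rewrite (@sweep_area R _ u (v a) (v b) r) //.
- congr (_ + _)%E; under eq_bigr do rewrite -EFinM.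
  rewrite sumEFin; congr EFin.
  by rewrite -mulr_sumr (sum_abs_cross_edges cv bmax amin) /F; field.
- exact: polygon_compact.
- exact: polygon_convex.
- exact: polygon_vertex.
- exact: polygon_vertex.
- by move=> p; apply: cross_polygon_le => i; rewrite amin bmax.
Qed.

Lemma leb3_swept_polygon (r : R) : 0 <= r -> (leb2 (polygon v) < +oo)%E ->
  leb3 (swept_event (polygon v) r) =
    (2 * pi * area (polygon v) + 2 * r * perimeter v)%:E.
Proof.
move=> r0 foo; have mA := measurable_swept_event r (@polygon_compact _ _ v).
have pi0 := pi_ge0 R.
rewrite leb3_ysection //.
have aE : leb2 (polygon v) = (area (polygon v))%:E.
  by rewrite /area fineK // ge0_fin_numE.
(* The slice at a direction outside [[0, 2 pi)] is empty; inside, it is the sweep along a unit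
   vector. *)
transitivity (\int[mu]_(th in `[0%R, (2 * pi)%R[) ((area (polygon v))%:E +
   \sum_(i < n) (r / 2)%:E *
     (`|cross (cos th, sin th) (vsub (v (ordS i)) (v i))|)%:E))%E.
  rewrite [RHS]integral_mkcond; apply: eq_integral => th _; rewrite patchE.
  have mS := measurable_ysection th mA.
  case: ifPn => [/set_mem|/negP nth]; rewrite /= ?in_itv /=.
    move=> th0.
    have SE : ysection (swept_event (polygon v) r) th =
              sweep (polygon v) (cos th, sin th) r.
      by apply/seteqP; split=> p; [move=> /ysectionP[]|move=> ?; apply/ysectionP].
    rewrite SE sweep_polygon_area ?aE //; last by rewrite -SE.
    apply/negP => /eqP[c0 s0]; have := cos2Dsin2 th.
    by rewrite c0 s0 expr0n /= addr0 => /eqP; rewrite eq_sym oner_eq0.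
  rewrite (_ : ysection _ _ = set0) ?measure0 //.
  apply/seteqP; split=> // p /ysectionP[/= th0 _]; apply: nth; apply/mem_set.
  by rewrite /= in_itv.
have mc i : measurable_fun setT
    (fun th : R => (`|cross (cos th, sin th) (vsub (v (ordS i)) (v i))|)%:E).
  apply/measurable_EFinP; apply: measurableT_comp => //.
  rewrite /cross /=; apply: measurable_funB; apply: measurable_funM => //.
    exact: continuous_measurable_fun (@continuous_cos R).
  exact: continuous_measurable_fun (@continuous_sin R).
have t0 i (x : R) :
    (0%:E <= (r / 2)%:E *
      (`|cross (cos x, sin x) (vsub (v (ordS i)) (v i))|)%:E)%E.
  by rewrite -EFinM lee_fin mulr_ge0 // divr_ge0.
have mt i D : measurable_fun D (fun x : R =>
    (r / 2)%:E * (`|cross (cos x, sin x) (vsub (v (ordS i)) (v i))|)%:E)%E.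
  by apply: measurable_funTS; apply: measurable_funeM; exact: mc.
rewrite ge0_integralD //; last 3 first.
- by move=> x _; rewrite lee_fin fine_ge0.
- by move=> x _; apply: sume_ge0 => i _; exact: t0.
- by apply: emeasurable_sum => i; exact: mt.
rewrite integral_cst //= lebesgue_measure_itv /= lte_fin.
rewrite ge0_integral_sum //; last by move=> i; exact: mt.
transitivity ((2 * pi * area (polygon v))%:E +
  \sum_(i < n) (2 * r * dist (v (ordS i)) (v i))%:E)%E; last first.
  by rewrite sumEFin -EFinD -mulr_sumr.
congr (_ + _)%E.
  by rewrite mulr_gt0 ?pi_gt0 // oppr0 adde0 -EFinM mulrC.
apply: eq_bigr => i _.
rewrite ge0_integralZl //; last 2 first.
- by apply: measurable_funTS; exact: mc.
- by rewrite lee_fin divr_ge0.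
rewrite integral_abs_cross -EFinM; congr EFin.
by rewrite /dist /vsub /=; field.
Qed.

End Target.

(** * The distribution function of the measured distance *)

Section Probability.
Variables (R : realType) (Omega : set (R * R)) (rmax : R).
Hypotheses (mO : measurable Omega) (Ooo : (leb2 Omega < +oo)%E).
Hypothesis rmax0 : 0 < rmax.

(** A square of side [rmax / 2] with a corner at [p] has its diagonal below [rmax], hence lies in
    [Omega]. *)
Lemma area_gt0_of_admissible (T : set (R * R)) (p : R * R) :
  T p -> admissible Omega T rmax -> 0 < area Omega.
Proof.
move=> Tp [_ adm]; pose h := rmax / 2.
have h0 : 0 < h by rewrite divr_gt0.
pose Q := `[p.1, p.1 + h]%classic `*` `[p.2, p.2 + h]%classic.
have QO : Q `<=` Omega.
  move=> q [/=]; rewrite !in_itv /= => /andP[q1 q1'] /andP[q2 q2'].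
  apply: adm; exists p => //; rewrite /dist.
  rewrite -(ger0_norm (ltW rmax0)) -sqrtr_sqr ler_sqrt ?sqr_ge0 //.
  by rewrite /h in q1' q2'; nra.
have mQ : measurable Q by apply: measurableX; exact: measurable_itv.
have Q0 : (0 < leb2 Q)%E.
  rewrite /leb2 /Q product_measure1E //; [|exact: measurable_itv..].
  rewrite /= !lebesgue_measure_itvcc ?lerDl ?ltW // -EFinM lte_fin.
  by rewrite mulr_gt0 // addrAC subrr add0r.
rewrite /area fine_gt0 // Ooo andbT; apply: lt_le_trans Q0 _.
by apply: le_measure; rewrite ?inE.
Qed.

(** Observability allows arbitrary real thresholds, so negative ones must be covered too. *)
Lemma prob_s_le_lt0 (T : set (R * R)) (r : R) : r < 0 ->
  prob_s_le Omega T rmax r = 0.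
Proof.
move=> r0; rewrite /prob_s_le.
have -> : hit T rmax r = set0.
  apply/seteqP; split=> // z [t [t0 tr _ _]].
  by move: (le_lt_trans (le_trans t0 tr) r0); rewrite ltxx.
by rewrite setI0 /leb3 measure0 mul0r.
Qed.

(** A sensor that detects [T] is within [rmax] of it, so admissibility already places it in
    [Omega]. *)
Lemma hit_swept_event (T : set (R * R)) (r : R) : admissible Omega T rmax ->
  (Omega `*` [set th | 0 <= th < 2 * pi]) `&` hit T rmax r =
  swept_event T (Num.min r rmax).
Proof.
move=> [_ adm]; apply/seteqP; split.
  move=> [[x y] th] [[/= _ th0] [t [t0 tr trm /= Tt]]].
  by split=> //; exists t; rewrite t0 le_min tr trm.
move=> [[x y] th] [/= th0 [t [/andP[t0]]]]; rewrite le_min.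
move=> /andP[tr trm] /= Tt.
split; last by exists t.
split=> //=; apply: adm; exists (x + t * cos th, y + t * sin th) => //.
rewrite /dist /=.
have -> : (x - (x + t * cos th)) ^+ 2 + (y - (y + t * sin th)) ^+ 2 = t ^+ 2.
  transitivity (t ^+ 2 * (cos th ^+ 2 + sin th ^+ 2)); first by ring.
  by rewrite cos2Dsin2 mulr1.
by rewrite sqrtr_sqr ger0_norm.
Qed.

Lemma prob_s_le_polygon (n : nat) (v : 'I_n -> R * R) (r : R) :
  adm_target Omega rmax v -> 0 <= r ->
  prob_s_le Omega (polygon v) rmax r =
  (2 * pi * area (polygon v) + 2 * Num.min r rmax * perimeter v)
    / (2 * pi * area Omega).
Proof.
move=> [cv adm] r0; rewrite /prob_s_le hit_swept_event // leb3_swept_polygon //.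
  by rewrite le_min r0 ltW.
(* The polygon has finite area because it lies in [Omega]. *)
apply: le_lt_trans Ooo; apply: le_measure; rewrite ?inE //; last by case: adm.
by apply: compact_measurable2; exact: polygon_compact.
Qed.

End Probability.

Theorem theorem3 (R : realType) (Omega : set (R * R)) (rmax : R) :
  measurable Omega -> (leb2 Omega < +oo)%E -> 0 < rmax ->
  (* L(T) and |T| are observable *)
  observable Omega rmax
    (fun n v => (perimeter v, area (polygon v))) /\
  (* no parameter of T not determined by L(T) and |T| is observable *)
  (forall (X : Type) (f : set (R * R) -> X),
     observable Omega rmax (fun n v => f (polygon v)) ->
     forall (n1 : nat) (v1 : 'I_n1 -> R * R) (n2 : nat) (v2 : 'I_n2 -> R * R),
       adm_target Omega rmax v1 -> adm_target Omega rmax v2 ->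
       perimeter v1 = perimeter v2 -> area (polygon v1) = area (polygon v2) ->
       f (polygon v1) = f (polygon v2)).
Proof.
(* Targets with equal perimeter and area have the same probability at every threshold, so no finite
   choice of thresholds separates them. *)
move=> mO Ooo rmax0; split; last first.
  move=> X f [k [s sP]] n1 v1 n2 v2 adm1 adm2 L12 A12; apply: sP => // i.
  have [s0|s0] := leP 0 (s i); last by rewrite !prob_s_le_lt0.
  by rewrite !prob_s_le_polygon // L12 A12.
(* Threshold 0 yields the area alone; [rmax] then adds the perimeter with the nonzero factor
   [2 * rmax]. *)
exists 2%N, (fun i => if i == ord0 then 0 else rmax).
move=> n1 v1 n2 v2 adm1 adm2 h.
(* Were this area 0, division by zero would make every probability 0; positivity lets the common
   denominator be cancelled. *)
have O0 : 0 < area Omega.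
  case: adm1 => -[n3 _] adm.
  apply: area_gt0_of_admissible adm => //.
  exact: polygon_vertex v1 (Ordinal (ltnW (ltnW n3))).
have pi0 := pi_gt0 R.
have D0 : 2 * pi * area Omega != 0 by rewrite gt_eqF // !mulr_gt0.
have := h ord_max; have := h ord0.
rewrite /= !prob_s_le_polygon // ?ltW //.
move=> /(mulIf (invr_neq0 D0)) h0 /(mulIf (invr_neq0 D0)).
move: h0; rewrite minxx (min_idPl (ltW rmax0)) !mulr0 !mul0r !addr0.
have pi2 : 2 * pi != 0 :> R by rewrite mulf_neq0 // gt_eqF.
move=> /(mulfI pi2) A12; rewrite A12 => /addrI.
have rm2 : 2 * rmax != 0 by rewrite mulf_neq0 // gt_eqF.
by move=> /(mulfI rm2) ->.
Qed.
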